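(* Let $m,n\ge 1$ be integers, $d=m+n$, and let $\Theta=(\theta_j^i)_{1\le j\le n,\,1\le i\le m}$ be a real $n\times m$ matrix with linear forms $L_j(\mathbf{x})=\sum_{i=1}^m\theta_j^i x_i$, $1\le j\le n$. Let $\mathbf{y}_\nu=(y_{\nu,1},\dots,y_{\nu,n})$ be the (finite or infinite) sequence of best approximation vectors of the transposed matrix ${}^T\Theta$, and let $\mathcal{N}_\Theta\subset\mathbb{R}^n$ be the set of all $\eta=(\eta_1,\dots,\eta_n)$ with $\inf_{\nu}\|\eta_1y_{\nu,1}+\dots+\eta_ny_{\nu,n}\|>0$. Let $\eta\in\mathcal{N}_\Theta$ and let $\varepsilon>0$ be such that $$\inf_{\nu}\|\eta_1y_{\nu,1}+\dots+\eta_ny_{\nu,n}\|\ge\varepsilon .$$ Put $$\Delta=\Delta(\Theta,\eta)=\liminf_{\mathbf{x}\in\mathbb{Z}^m,\ |\mathbf{x}|\to+\infty}\Big(\max_{1\le j\le n}\|L_j(\mathbf{x})-\eta_j\|\Big)^n\Big(\max_{1\le i\le m}|x_i|\Big)^m .$$ Then for every vector $\alpha=(\alpha_1,\dots,\alpha_n)\in\mathbb{R}^n$, $$\liminf_{\mathbf{x}\in\mathbb{Z}^m,\ |\mathbf{x}|\to+\infty}\Big(\max_{1\le j\le n}\|L_j(\mathbf{x})-\alpha_j\|\Big)^n\Big(\max_{1\le i\le m}|x_i|\Big)^m\le G_{m,n}(\varepsilon)\,\Delta^{d(d-1)},$$ where $$G_{m,n}(\varepsilon)=\frac{d^d\,(m^mn^n)^{d(d-1)}}{(\varepsilon^d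 K R_{m,n})^{d(d-1)}},\qquad R_{m,n}=\max_{0<r<1}r^n(1-r)^m,$$ $$K=\frac{1}{2^{d-1}\sqrt{d}}\,\mathrm{vol}_{d-1}\{\mathbf{z}=(z_1,\dots,z_d)\in[-1,1]^d:\ z_1+\dots+z_d=0\}.$$
   Context: $\|\cdot\|$ denotes the distance from a real number to the nearest integer; $|\mathbf{x}|=\max_i|x_i|$; $\mathrm{vol}_{d-1}$ is $(d-1)$-dimensional volume in the hyperplane $z_1+\dots+z_d=0$. The quantity $\Delta$ may equal $+\infty$, in which case the right-hand side of the inequality is $+\infty$. Best approximations of ${}^T\Theta$: put ${}^TL_i(\mathbf{y})=\sum_{j=1}^n\theta_j^iy_j$ for $1\le i\le m$ and $\mathbf{y}=(y_1,\dots,y_n)\in\mathbb{Z}^n$, and for $t\ge1$ let $${}^T\psi(t)=\min_{\mathbf{y}\in\mathbb{Z}^n:\ 0<\max_j|y_j|\le t}\ \max_{1\le i\le m}\|{}^TL_i(\mathbf{y})\| .$$ A sequence of best approximation vectors is a sequence of nonzero vectors $\mathbf{y}_\nu\in\mathbb{Z}^n$, $\nu=1,2,3,\dots$, such that, with $Y_\nu=\max_j|y_{\nu,j}|$ and $\zeta_\nu=\max_i\|{}^TL_i(\mathbf{y}_\nu)\|$, one has $1=Y_1<Y_2<\cdots$, $\zeta_1>\zeta_2>\cdots$, and ${}^T\psi(t)=\zeta_\nu$ for all $Y_\nu\le t<Y_{\nu+1}$. The sequence is finite exactly when some $\zeta_\nu=0$; in that case it terminates at that $\nu$, and ${}^T\psi(t)=0$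 for all $t\ge Y_\nu$. Where several vectors are possible (e.g. $\pm\mathbf{y}_\nu$), one such sequence is fixed. Infima over $\nu$ are over all indices of the sequence. *)

(* Defs.v *)
From HB Require Import structures.
From mathcomp Require Import all_boot all_order all_algebra.
From mathcomp Require Import all_classical all_reals all_analysis.

Set Implicit Arguments.
Unset Strict Implicit.
Unset Printing Implicit Defensive.

Import Order.TTheory GRing.Theory Num.Theory.

Local Open Scope classical_set_scope.
Local Open Scope ring_scope.

(* Distance to the nearest integer; the infimum is attained. *)
Definition int_dist (R : realType) (a : R) : R :=
  inf [set `|a - z%:~R| | z in [set: int]].

Definition sup_norm (k : nat) (x : 'rV[int]_k) : nat :=
  (\max_(i < k) `|x 0%R i|)%N.

Definition lin_form (R : realType) (k l : nat) (A : 'M[R]_(k, l))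
    (x : 'rV[int]_l) (j : 'I_k) : R :=
  \sum_(i < l) A j i * (x 0 i)%:~R.

(* max_j || A_j(x) - eta_j ||; starting the maximum at 0 is harmless, since
   distances are nonnegative. *)
Definition approx_error (R : realType) (k l : nat) (A : 'M[R]_(k, l))
    (eta : 'rV[R]_k) (x : 'rV[int]_l) : R :=
  \big[Num.max/0]_(j < k) int_dist (lin_form A x j - eta 0 j).

(* The infimum is a minimum for t >= 1 and l >= 1: the set is then finite and
   nonempty. *)
Definition irrationality_fun (R : realType) (k l : nat) (A : 'M[R]_(k, l))
    (t : R) : R :=
  inf [set approx_error A 0 y | y in
    [set y : 'rV[int]_l | (0 < sup_norm y)%N /\ (sup_norm y)%:R <= t]].

(* A sequence indexed from 0 is infinite for [last = None] and has the terms
   0, ..., N for [last = Some N]; in particular it is never empty. *)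
Definition indices (last : option nat) : set nat :=
  [set nu | if last is Some N then (nu <= N)%N else true].

Definition best_approximations (R : realType) (k l : nat) (A : 'M[R]_(k, l))
    (last : option nat) (y : nat -> 'rV[int]_l) : Prop :=
  let Y nu := sup_norm (y nu) in
  let zeta nu := approx_error A 0 (y nu) in
  [/\ forall nu, indices last nu -> y nu != 0,
      Y 0%N = 1%N,
      forall nu, indices last nu.+1 ->
        [/\ (Y nu < Y nu.+1)%N,
            zeta nu.+1 < zeta nu &
            forall t : R, (Y nu)%:R <= t -> t < (Y nu.+1)%:R ->
              irrationality_fun A t = zeta nu],
      forall nu, indices last nu -> (zeta nu = 0 <-> last = Some nu) &
      forall nu, last = Some nu ->
        forall t : R, (Y nu)%:R <= t -> irrationality_fun A t = 0].

Definition inf_dist (R : realType) (n : nat) (last : option nat)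
    (y : nat -> 'rV[int]_n) (eta : 'rV[R]_n) : R :=
  inf [set int_dist (\sum_(j < n) eta 0 j * (y nu 0 j)%:~R)
      | nu in indices last].

Definition nonsingular_shifts (R : realType) (n : nat) (last : option nat)
    (y : nat -> 'rV[int]_n) : set 'rV[R]_n :=
  [set eta | 0 < inf_dist last y eta].

(* liminf of f(x) as |x| -> +oo in Z^k, with values in [-oo, +oo]; the library's
   [limf_einf] needs a filtered structure, which row vectors over int lack. *)
Definition liminf_infty (R : realType) (k : nat) (f : 'rV[int]_k -> \bar R)
    : \bar R :=
  ereal_sup [set ereal_inf [set f x | x in [set x | (N <= sup_norm x)%N]]
            | N in [set: nat]].

Definition approx_liminf (R : realType) (m n : nat) (Theta : 'M[R]_(n, m))
    (eta : 'rV[R]_n) : \bar R :=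
  liminf_infty (fun x : 'rV[int]_m =>
    (approx_error Theta eta x ^+ n * (sup_norm x)%:R ^+ m)%:E).

(* k-dimensional Lebesgue measure of a measurable subset of R^k, as the k-fold
   product of the measure on the line: each step is the integral of sections
   by which the library defines [lebesgue_measure \x mu]. *)
Fixpoint lebesgue_rV (R : realType) (k : nat) : set 'rV[R]_k -> \bar R :=
  match k return set 'rV[R]_k -> \bar R with
  | 0%N => fun A => (\1_A (0 : 'rV[R]_0))%:E
  | k'.+1 => fun A => (\int[lebesgue_measure]_(s in [set: R])
      lebesgue_rV [set u : 'rV[R]_k' | A (row_mx (s%:M : 'rV[R]_1) u)])%E
  end.

(* Euclidean k-dimensional volume in the k-dimensional subspace of R^d with
   basis the rows of B: the parametrization u |-> u B multiplies
   k-dimensional volume by the square root of the Gram determinant. *)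
Definition subspace_vol (R : realType) (k d : nat) (B : 'M[R]_(k, d))
    (S : set 'rV[R]_d) : \bar R :=
  ((Num.sqrt (\det (B *m B^T)))%:E * lebesgue_rV [set u | S (u *m B)])%E.

(* The basis e_i - e_d (1 <= i < d) of the hyperplane z_1 + ... + z_d = 0. *)
Definition hyperplane_basis (R : realType) (d : nat) : 'M[R]_(d.-1, d) :=
  \matrix_(i < d.-1, j < d)
    ((j == i :> nat)%:R - (j == d.-1 :> nat)%:R).

Definition hyperplane_vol (R : realType) (d : nat) (S : set 'rV[R]_d)
    : \bar R :=
  subspace_vol (hyperplane_basis R d) S.

Definition cube_section (R : realType) (d : nat) : set 'rV[R]_d :=
  [set z | (forall i, -1 <= z 0 i <= 1) /\ \sum_(i < d) z 0 i = 0].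

Definition K_const (R : realType) (d : nat) : R :=
  (2 ^+ d.-1 * Num.sqrt d%:R)^-1 * fine (hyperplane_vol (@cube_section R d)).

(* The supremum is a maximum for m, n >= 1. *)
Definition R_const (R : realType) (m n : nat) : R :=
  sup [set r ^+ n * (1 - r) ^+ m | r in [set r : R | 0 < r < 1]].

Definition G_const (R : realType) (m n : nat) (eps : R) : R :=
  let d := (m + n)%N in
  (d%:R ^+ d * (m%:R ^+ m * n%:R ^+ n) ^+ (d * d.-1))
  / (eps ^+ d * K_const R d * R_const R m n) ^+ (d * d.-1).

(* Main.v *)
Require Import Defs.
From HB Require Import structures.
From mathcomp Require Import all_boot all_order all_algebra.
From mathcomp Require Import all_classical all_reals all_analysis.
From mathcomp Require Import measurable_realfun zify ring lra.
Set Implicit Arguments.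
Unset Strict Implicit.
Unset Printing Implicit Defensive.
Import Order.TTheory GRing.Theory Num.Theory.
Local Open Scope classical_set_scope.
Local Open Scope ring_scope.

(** Fix an integer point x far out and put X = |x|, rho = max_j ||L_j(x) - eta_j||.
    Exchanging the double sum in y.L(x) gives, for every integer y,
      ||eta.y|| <= n rho |y| + m X max_i ||TL_i(y)||
    ([int_dist_transference]).  At y = y_nu the left side is at least eps, so
    y_nu and zeta_nu cannot both be small; by the extremality of best
    approximations the same holds for every y <> 0: with
    U = r eps / (n rho) and V = (1 - r) eps / (m X), 0 < r < 1, the box
    |y| <= U, max_i ||TL_i(y)|| < V contains no nonzero y ([gap_of_shift]).
    If rho^n X^m = D, the number B = (U^n V^m)^-1 is
    n^n m^m D / (eps^d r^n (1 - r)^m), whatever x is.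

    An empty box is large in the dual sense.  Regard it as the unit cube of a
    lattice in R^d all of whose nonzero vectors have norm at least 1.  Every
    point of R^d is then within sqrt(c_d) of the dual lattice, where c_d
    depends only on d ([dual_covering]).  Read in coordinates, every system
    L(x) - alpha has an integer solution with error at most sqrt(c_d) / U and x
    within sqrt(c_d) / V of a prescribed centre ([inhomogeneous_of_gap]).
    Placing the centre far out gives
      liminf (error^n |x|^m) <= (2 s)^d B    whenever c_d < s^2
    ([approx_liminf_le]).

    In the limit D -> Delta, and with r optimal, B becomes
    n^n m^m Delta / (eps^d R_{m,n}), and the pigeonhole principle yields
    B >= 1 ([gap_volume_le]); hence B <= B^(d(d-1)).  The right-hand side of the
    theorem is (d / K^(d-1))^d B^(d(d-1)) ([G_constE]), so the choice
    s = d / (2 K^(d-1)) proves it as soon as c_d < s^2.  Since c_d grows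
    like (7/5)^d, it is enough to know that K <= 1 for d = 2 and K <= 5/6
    for d >= 3 ([covering_const_lt]). *)

(** * Covering by the dual of a lattice without short vectors *)

Lemma near_int (R : realType) (x : R) : exists k : int, `|k%:~R - x| <= 2^-1.
Proof.
exists (Num.floor (x + 2^-1)).
have := floor_le (x + 2^-1); have := floorD1_gt (x + 2^-1).
rewrite intrD ler_norml => h1 h2; apply/andP; split; lra.
Qed.

Definition sqnorm (R : realType) (N : nat) (v : 'rV[R]_N) : R := (v *m v^T) 0 0.

Lemma sqnormE (R : realType) (N : nat) (v : 'rV[R]_N) :
  sqnorm v = \sum_i v 0 i ^+ 2.
Proof. by rewrite /sqnorm mxE; apply: eq_bigr => i _; rewrite mxE -expr2. Qed.

Lemma sqnorm_ge0 (R : realType) (N : nat) (v : 'rV[R]_N) : 0 <= sqnorm v.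
Proof. by rewrite sqnormE sumr_ge0// => i _; rewrite sqr_ge0. Qed.

Lemma sqnormZ (R : realType) (N : nat) (a : R) (v : 'rV[R]_N) :
  sqnorm (a *: v) = a ^+ 2 * sqnorm v.
Proof. by rewrite /sqnorm linearZ /= -scalemxAl -scalemxAr !mxE expr2 mulrA. Qed.

Lemma sqnorm_pythagoras (R : realType) (N : nat) (a : R) (p v : 'rV[R]_N) :
  v *m p^T = 0 -> sqnorm (a *: p + v) = a ^+ 2 * sqnorm p + sqnorm v.
Proof.
move=> vp; have pv : p *m v^T = 0 by rewrite -[p]trmxK -trmx_mul vp trmx0.
rewrite -sqnormZ /sqnorm linearD /= mulmxDr !mulmxDl linearZ /=.
by rewrite -!scalemxAr -!scalemxAl vp pv !scaler0 addr0 add0r mxE.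
Qed.

(** A lattice is given by a matrix P whose rows generate it.  With p its first
    generator, [proj_orth p P] is the orthogonal projection of the other
    generators along p, and [proj_coef p P] lists the coefficients of p
    removed by it (the Gram-Schmidt coefficients). *)
Definition proj_coef (R : realType) (N d : nat) (p : 'rV[R]_N)
  (P : 'M[R]_(d, N)) : 'cV[R]_d := (sqnorm p)^-1 *: (P *m p^T).

Definition proj_orth (R : realType) (N d : nat) (p : 'rV[R]_N)
  (P : 'M[R]_(d, N)) : 'M[R]_(d, N) := P - proj_coef p P *m p.

Lemma sqnorm_col_mx (R : realType) (N d : nat) (p : 'rV[R]_N)
    (P : 'M[R]_(d, N)) (a : R) (u : 'rV[R]_d) : sqnorm p != 0 ->
  sqnorm (row_mx a%:M u *m col_mx p P) =
  (a + (u *m proj_coef p P) 0 0) ^+ 2 * sqnorm p + sqnorm (u *m proj_orth p P).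
Proof.
move=> p0; rewrite -sqnorm_pythagoras; last first.
  rewrite -mulmxA /proj_orth mulmxBl -mulmxA [p *m _]mx11_scalar -/(sqnorm p).
  by rewrite mul_mx_scalar scalerA divff// scale1r subrr mulmx0.
congr sqnorm; rewrite mul_row_col mul_scalar_mx /proj_orth mulmxBr scalerDl.
by rewrite mulmxA [X in X *m p]mx11_scalar mul_scalar_mx addrACA subrr addr0 addrC.
Qed.

(** The Cauchy-Schwarz inequality for the vectors (a / sqrt p, sqrt e) and
    (b sqrt p, sqrt q), the second product having been weakened by the
    hypothesis on c. *)
Lemma weighted_cauchy (R : realFieldType) (a b c p q e : R) :
  0 < p -> 0 <= q -> 0 <= e -> c ^+ 2 <= e * q ->
  (a * b + c) ^+ 2 <= (a ^+ 2 / p + e) * (b ^+ 2 * p + q).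
Proof.
move=> p0 q0 e0 ce.
have [e_eq0|e_neq0] := eqVneq e 0.
  have -> : c = 0.
    by apply/eqP; rewrite -sqrf_eq0 eq_le sqr_ge0 andbT (le_trans ce)// e_eq0 mul0r.
  rewrite e_eq0 !addr0 exprMn mulrDr.
  have -> : a ^+ 2 / p * (b ^+ 2 * p) = a ^+ 2 * b ^+ 2 by field; exact: lt0r_neq0.
  by rewrite lerDl mulr_ge0// divr_ge0 ?sqr_ge0// ltW.
have e_gt0 : 0 < e by rewrite lt0r e_neq0.
have hq : c ^+ 2 / e <= q by rewrite ler_pdivrMr// mulrC.
have h : (a * b + c) ^+ 2 <= (a ^+ 2 / p + e) * (b ^+ 2 * p + c ^+ 2 / e).
  rewrite -subr_ge0.
  have -> : (a ^+ 2 / p + e) * (b ^+ 2 * p + c ^+ 2 / e) - (a * b + c) ^+ 2 =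
     (a * c - b * p * e) ^+ 2 / (p * e).
    by field; rewrite e_neq0 lt0r_neq0.
  by rewrite divr_ge0 ?sqr_ge0// mulr_ge0// ltW.
apply: (le_trans h); rewrite ler_wpM2l ?lerD2l//.
by rewrite addr_ge0// divr_ge0 ?sqr_ge0// ltW.
Qed.

Notation intv := (map_mx intr).

(** Points of the dual lattice are seen as integer linear forms w on Z^(1+d).
    Rounding the value of s on the first generator costs at most 1/2, which
    in the dual norm is 1 / (2 |p|); what remains is a form on the projected
    lattice, shifted by the Gram-Schmidt coefficients, to which the hypothesis
    applies.  The two errors are orthogonal, so their squares add up. *)
Lemma covering_step (R : realType) (N d : nat) (p : 'rV[R]_N)
    (P : 'M[R]_(d, N)) (lam c : R) : 0 < lam -> lam <= sqnorm p -> 0 <= c ->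
  (forall s : 'rV[R]_d, exists w : 'rV[int]_d, forall u : 'rV[R]_d,
     ((intv w - s) *m u^T) 0 0 ^+ 2 <= c * sqnorm (u *m proj_orth p P)) ->
  forall s : 'rV[R]_(1 + d), exists w : 'rV[int]_(1 + d),
    forall u : 'rV[R]_(1 + d),
     ((intv w - s) *m u^T) 0 0 ^+ 2 <=
       (4^-1 / lam + c) * sqnorm (u *m col_mx p P).
Proof.
move=> lam0 lamp c0 IH s.
have p0 : 0 < sqnorm p by exact: lt_le_trans lamp.
have [w0 hw0] := near_int (lsubmx s 0 0).
set a := w0%:~R - _ in hw0.
have [w1 hw1] := IH (rsubmx s + a *: (proj_coef p P)^T).
exists (row_mx w0%:M w1) => u.
have := hw1 (rsubmx u); set c1 := ((_ *m _) 0 0 : R) => hc1.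
rewrite -[u]hsubmxK [lsubmx u]mx11_scalar sqnorm_col_mx ?gt_eqF//.
set b := lsubmx u 0 0; set k := (_ *m proj_coef _ _) 0 0.
have -> : ((intv (row_mx w0%:M w1) - s) *m (row_mx b%:M (rsubmx u))^T) 0 0
   = a * (b + k) + c1.
  have c1E : ((intv w1 - rsubmx s) *m (rsubmx u)^T) 0 0 = c1 + a * k.
    rewrite /c1 opprD addrA [in RHS]mulmxBl -scalemxAl -trmx_mul [in RHS]mxE.
    by rewrite [X in _ = _ + X + _]mxE [X in _ = _ - X + _]mxE [X in _ = _ - _ * X + _]mxE -/k subrK.
  rewrite -[s in LHS]hsubmxK map_row_mx opp_row_mx add_row_mx tr_row_mx mul_row_col.
  rewrite mxE c1E tr_scalar_mx mul_mx_scalar mxE.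
  have -> : (intv w0%:M - lsubmx s) 0 0 = a by rewrite /a !mxE eqxx mulr1n.
  by ring.
have hle := weighted_cauchy a (b + k) p0 (sqnorm_ge0 _) c0 hc1.
apply: (le_trans hle); apply: ler_wpM2r.
  by rewrite addr_ge0 ?sqnorm_ge0// mulr_ge0 ?sqr_ge0// ltW.
rewrite lerD2r ler_pM ?sqr_ge0 ?invr_ge0 ?(ltW p0)//; last by rewrite lef_pV2.
by rewrite -real_normK ?num_real// (_ : 4^-1 = 2^-1 ^+ 2) ?lerXn2r ?nnegrE//; field.
Qed.

(** A primitive integer vector extends to a basis of Z^(d+1): this is the Smith
    normal form of a single row. *)
Lemma unimodular_row (d : nat) (v : 'rV[int]_d.+1) : v != 0 ->
  exists A : 'M[int]_d.+1, exists k : int,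
    [/\ A \in unitmx, k != 0 & v = k *: row 0 A].
Proof.
move=> v0; have [L Lu [A Au [ds _ vE]]] := int_Smith_normal_form v.
exists A, (L 0 0 * ds`_0).
have vE' : v = (L 0 0 * ds`_0) *: row 0 A.
  rewrite vE; apply/rowP => j; rewrite !mxE (bigD1 ord0)//= [X in _ + X]big1 => [|i i0].
    by rewrite addr0 !mxE big_ord1 mxE eqxx mulr1n.
  rewrite mxE big_ord1 mxE (_ : (_ == _ :> nat) = false) ?mulr0n ?mulr0 ?mul0r//.
  by apply/negbTE; rewrite eq_sym.
split=> //; apply: contraNneq v0 => k0.
by rewrite vE' k0 scale0r.
Qed.

(** Here mu is the infimum of the squared norms of nonzero lattice vectors.  Some
    vector v comes within the factor 8/7 of it, and the primitive vector on
    the ray of v is at most as long. *)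
Lemma near_minimal_basis (R : realType) (N d : nat) (P : 'M[R]_(d.+1, N))
    (lam : R) : 0 < lam ->
  (forall u : 'rV[int]_d.+1, u != 0 -> lam <= sqnorm (intv u *m P)) ->
  exists A : 'M[int]_d.+1, exists mu : R,
    [/\ A \in unitmx, lam <= mu, sqnorm (intv (row 0 A) *m P) <= 8 / 7 * mu &
        forall u : 'rV[int]_d.+1, u != 0 -> mu <= sqnorm (intv u *m P)].
Proof.
move=> lam0 hP.
pose S := [set sqnorm (intv u *m P) | u in [set u : 'rV[int]_d.+1 | u != 0]].
have lbS : has_lbound S by exists lam => _ [u /= u0 <-]; exact: hP.
have S0 : S !=set0.
  by exists (sqnorm (intv (delta_mx 0 0 : 'rV[int]_d.+1) *m P)), (delta_mx 0 0);
    rewrite //=; apply/eqP => /matrixP/(_ 0 0); rewrite !mxE.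
have lam_mu : lam <= inf S by apply: lb_le_inf => // _ [u /= u0 <-]; exact: hP.
have mu0 : 0 < inf S by exact: lt_le_trans lam_mu.
have [|_ [v /= v0 <-] hv] := @inf_adherent _ S (inf S / 7) _ (conj S0 lbS).
  by rewrite divr_gt0.
have [A [k [Au k0 vE]]] := unimodular_row v0.
exists A, (inf S); split=> //; last by move=> u u0; apply: ge_inf => //; exists u.
have : sqnorm (intv (row 0 A) *m P) <= sqnorm (intv v *m P).
  rewrite vE map_mxZ /= -scalemxAl sqnormZ ler_peMl ?sqnorm_ge0//.
  rewrite -rmorphXn /= -[1]/(1%:~R) ler_int.
  by rewrite -gtz0_ge1 exprn_even_gt0.
by move=> /le_trans; apply; apply: ltW; apply: (lt_le_trans hv); lra.
Qed.

(** The solution of c_0 = 0, c_(d+1) = 1/4 + (7/5) c_d. *)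
Definition covering_const (R : realType) (d : nat) : R := 5 / 8 * ((7 / 5) ^+ d - 1).

Lemma covering_const_ge0 (R : realType) d : 0 <= covering_const R d.
Proof. by rewrite mulr_ge0 ?subr_ge0 ?exprn_ege1//; lra. Qed.

(** Induction on the dimension, as in Hermite's reduction.  If the first generator
    p is nearly shortest, with |p|^2 <= (8/7) mu, then a projected vector can
    be lifted to a lattice vector longer by at most |p|^2 / 4 <= (2/7) mu, so
    the squared norms in the projected lattice are at least (5/7) mu.  This
    loss is the ratio 7/5 of [covering_const].

    The bound says that w - s has dual norm at most sqrt(c_d / lam). *)
Lemma dual_covering (R : realType) (N d : nat) (P : 'M[R]_(d, N)) (lam : R) :
  0 < lam ->
  (forall u : 'rV[int]_d, u != 0 -> lam <= sqnorm (intv u *m P)) ->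
  forall s : 'rV[R]_d, exists w : 'rV[int]_d, forall u : 'rV[R]_d,
    ((intv w - s) *m u^T) 0 0 ^+ 2 <= covering_const R d / lam * sqnorm (u *m P).
Proof.
elim: d P lam => [|d IH] P lam lam0 hP s.
  exists 0 => u; rewrite (thinmx0 u) trmx0 mulmx0 mxE expr0n/=.
  by rewrite mulr_ge0 ?sqnorm_ge0// divr_ge0 ?covering_const_ge0// ltW.
have [A [mu [Au lam_mu hA hmu]]] := near_minimal_basis lam0 hP.
have mu0 : 0 < mu by exact: lt_le_trans lam_mu.
pose P' : 'M[R]_(1 + d, N) := intv A *m P.
pose p := usubmx P'; pose P1 := dsubmx P'.
have pE : p = intv (row 0 A) *m P.
  rewrite /p /P' map_row -row_mul; apply/rowP => j; rewrite !mxE.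
  by apply: eq_bigr => i _; congr (_ * _); rewrite !mxE; congr (_%:~R); congr (A _ _); apply: val_inj.
have uA0 (u : 'rV[int]_d.+1) : u != 0 -> u *m A != 0.
  apply: contraNneq => /(congr1 (mulmx^~ (invmx A))).
  by rewrite mulmxK// mul0mx => ->.
have hP' (u : 'rV[int]_(1 + d)) : u != 0 -> mu <= sqnorm (intv u *m P').
  by move=> u0; rewrite /P' mulmxA -map_mxM; apply/hmu/uA0.
have mup : mu <= sqnorm p.
  rewrite pE; apply: hmu; rewrite rowE; apply: uA0.
  by apply/eqP => /matrixP/(_ 0 0); rewrite !mxE.
have p0 : 0 < sqnorm p by exact: lt_le_trans mup.
have P'E : P' = col_mx p P1 by rewrite vsubmxK.
have hP1 (u : 'rV[int]_d) : u != 0 -> 5 / 7 * mu <= sqnorm (intv u *m proj_orth p P1).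
  move=> u0.
  (* Lift of u to a lattice vector whose component along p is at most |p| / 2. *)
  have [k hk] := near_int (- (intv u *m proj_coef p P1) 0 0).
  have /hP' : row_mx k%:M u != 0.
    by apply: contraNneq u0 => /(congr1 rsubmx); rewrite row_mxKr linear0 => ->.
  rewrite P'E map_row_mx (_ : intv k%:M = (k%:~R)%:M); last first.
    by apply/matrixP => i j; rewrite !mxE rmorphMn.
  rewrite sqnorm_col_mx ?gt_eqF// => hmu'.
  rewrite opprK in hk; set x := k%:~R + _ in hk hmu'.
  have : x ^+ 2 <= 4^-1.
    by rewrite -real_normK ?num_real// (_ : 4^-1 = 2^-1 ^+ 2) ?lerXn2r ?nnegrE//; field.
  move=> /(ler_wpM2r (ltW p0)); rewrite -pE in hA; lra.
have mu5 : 0 < 5 / 7 * mu by lra.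
have [w hw] := @covering_step _ _ _ p P1 mu _ mu0 mup
   (divr_ge0 (covering_const_ge0 R d) (ltW mu5)) (IH _ _ mu5 hP1) (s *m (intv A)^T).
exists (w *m (invmx A)^T) => u.
have AVK : intv (invmx A) *m intv A = 1%:M :> 'M[R]_d.+1.
  by rewrite -map_mxM mulVmx// map_mx1.
have := hw (u *m intv (invmx A)); rewrite -P'E /P' mulmxA -[u *m _ *m _]mulmxA AVK mulmx1.
rewrite trmx_mul mulmxA.
have -> : (intv w - s *m (intv A)^T) *m (intv (invmx A))^T = intv (w *m (invmx A)^T) - s.
  by rewrite mulmxBl -mulmxA -trmx_mul AVK trmx1 mulmx1 map_mxM map_trmx.
move=> /le_trans; apply; rewrite ler_wpM2r ?sqnorm_ge0//.
have -> : 4^-1 / mu + covering_const R d / (5 / 7 * mu) = covering_const R d.+1 / mu.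
  by rewrite /covering_const exprS; field; exact: lt0r_neq0.
by rewrite ler_wpM2l ?covering_const_ge0// lef_pV2.
Qed.

(** * The volume of the central cube section *)

(** Solving z_1 + ... + z_(k+1) = 0 for the last coordinate turns the central
    section of [-1, 1]^(k+1) into [slab k 0].  The shift t makes the family
    stable under slicing by the first coordinate. *)
Definition slab (R : realType) (k : nat) (t : R) : set 'rV[R]_k :=
  [set u | (forall i, -1 <= u 0 i <= 1) /\ -1 <= t + \sum_i u 0 i <= 1].

Arguments slab {R} k t _.

Definition slab_vol (R : realType) (k : nat) (t : R) : \bar R :=
  lebesgue_rV (slab k t).

Lemma lebesgue_rV_ge0 (R : realType) (k : nat) (A : set 'rV[R]_k) :
  (0 <= lebesgue_rV A)%E.
Proof.
by elim: k A => [|k IH] A /=; [rewrite lee_fin|apply: integral_ge0 => s _; exact: IH].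
Qed.

Lemma lebesgue_rV0 (R : realType) (k : nat) : @lebesgue_rV R k set0 = 0%E.
Proof.
elim: k => [|k IH] /=; first by rewrite indic0.
by rewrite (eq_integral (cst 0%E)) ?integral0// => s _; exact: IH.
Qed.

(** Monotonicity for integrands that are not assumed measurable: the integral of
    a nonnegative function is a supremum over the simple functions below it. *)
Lemma ge0_le_integral_setT (R : realType) (f g : R -> \bar R) :
  (forall s, 0 <= f s)%E -> (forall s, f s <= g s)%E ->
  (\int[lebesgue_measure]_(s in setT) f s <= \int[lebesgue_measure]_(s in setT) g s)%E.
Proof.
move=> f0 fg; have g0 s : (0 <= g s)%E by exact: le_trans (fg s).
rewrite !ge0_integralTE//; apply: le_ereal_sup => _ [h hf <-].
by exists h => // s; exact: le_trans (fg s).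
Qed.

(** The test functions to which [slab_vol] is compared. *)
Definition step (R : realType) (c a b : R) (s : R) : \bar R :=
  (c * \1_(`[a, b] : set R) s)%:E.

Lemma step_ge0 (R : realType) (c a b s : R) : 0 <= c -> (0 <= step c a b s)%E.
Proof. by move=> c0; rewrite lee_fin mulr_ge0. Qed.

Lemma measurable_step (R : realType) (c a b : R) (D : set R) :
  measurable_fun D (step c a b).
Proof.
by apply/measurable_EFinP; apply: measurable_funM => //; exact: measurable_indic.
Qed.

Lemma integral_step (R : realType) (c a b : R) : 0 <= c -> a <= b ->
  (\int[lebesgue_measure]_(s in setT) step c a b s)%E = (c * (b - a))%:E.
Proof.
move=> c0 ab; under eq_integral do rewrite /step EFinM.
rewrite ge0_integralZl_EFin//; last first.
  by apply/measurable_EFinP; exact: measurable_indic.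
rewrite integral_indic// setIT /= lebesgue_measure_itv /= lte_fin.
have [ltab|ltba|->] := ltgtP a b; first by rewrite EFinM EFinB.
  by move: ab; rewrite leNgt ltba.
by rewrite subrr mulr0 mule0.
Qed.

(** Up to a factor 2^k, [slab_vol k t] is the probability that t plus a sum of k
    independent uniform variables on [-1, 1] lies in [-1, 1]; slicing is the
    convolution recursion. *)
Lemma slab_volS (R : realType) (k : nat) (t : R) :
  slab_vol k.+1 t = (\int[lebesgue_measure]_(s in setT)
     (step 1 (-1) 1 s * slab_vol k (t + s)))%E.
Proof.
rewrite /slab_vol /=; apply: eq_integral => s _.
have E : [set u : 'rV[R]_k | @slab R (1 + k) t (row_mx s%:M u)] =
    [set u | -1 <= s <= 1 /\ slab k (t + s) u].
  apply/seteqP; split => u /=.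
    move=> [h1 h2]; split; first by have := h1 (lshift k (0 : 'I_1)); rewrite row_mxEl mxE.
    split; first by move=> i; have := h1 (rshift 1 i); rewrite row_mxEr.
    move: h2; rewrite big_split_ord /= big_ord1 row_mxEl mxE addrA.
    by under eq_bigr do rewrite row_mxEr.
  move=> [h1 [h2 h3]]; split.
    by move=> i; have [j ->|j ->] := split_ordP i; rewrite ?row_mxEr ?row_mxEl ?(ord1 j) ?mxE.
  rewrite big_split_ord /= big_ord1 row_mxEl mxE addrA.
  by under eq_bigr do rewrite row_mxEr.
rewrite /step mul1r; set X := (X in lebesgue_rV X); rewrite [X](E : _ = _).
have [h|h] := boolP (-1 <= s <= 1).
  rewrite indicE mem_set/= ?in_itv// mul1e; congr lebesgue_rV.
  by apply/seteqP; split=> [u []|u].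
rewrite indicE memNset/= ?in_itv/= ?mul0e; last exact/negP.
by rewrite -(lebesgue_rV0 R k); congr lebesgue_rV; apply/seteqP; split=> u []; rewrite ?(negbTE h).
Qed.

Lemma slab_vol_ge0 (R : realType) (k : nat) (t : R) : (0 <= slab_vol k t)%E.
Proof. exact: lebesgue_rV_ge0. Qed.

Lemma slab_vol0 (R : realType) (t : R) : slab_vol 0%N t = ((-1 <= t <= 1)%R : bool)%:R%:E.
Proof.
rewrite /slab_vol /= indicE; congr ((nat_of_bool _)%:R%:E); apply/idP/idP.
  by rewrite inE => -[_]; rewrite big_ord0 addr0.
by move=> h; rewrite inE; split=> [[]//|]; rewrite big_ord0 addr0.
Qed.

Lemma slab_vol_le_double (R : realType) (k : nat) (c : R) :
  (forall t, slab_vol k t <= c%:E)%E -> forall t, (slab_vol k.+1 t <= (2 * c)%:E)%E.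
Proof.
move=> h t; rewrite slab_volS.
have c0 : 0 <= c by rewrite -lee_fin (le_trans _ (h 0))// slab_vol_ge0.
rewrite (_ : 2 * c = c * (1 - -1)); last by ring.
rewrite -(@integral_step R c (-1) 1)//.
apply: ge0_le_integral_setT => s; first by rewrite mule_ge0 ?slab_vol_ge0// step_ge0.
by rewrite /step mul1r [leRHS]EFinM muleC lee_wpmul2r ?lee_fin.
Qed.

Lemma slab_vol_ge1 (R : realType) (k : nat) (t : R) : -1 <= t <= 1 ->
  (1 <= slab_vol k t)%E.
Proof.
elim: k t => [|k IH] t ht; first by rewrite slab_vol0 ht.
rewrite slab_volS; have [a [b [ab h]]] : exists a b : R, b - a = 1 /\
    forall s, a <= s <= b -> -1 <= s <= 1 /\ -1 <= t + s <= 1.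
  have [t0|t0] := leP 0 t; [exists (-1), 0|exists 0, 1]; split; try by lra.
    by move=> s; lra.
  by move=> s; lra.
rewrite (_ : 1%E = (1 * (b - a))%:E); last by rewrite ab mulr1.
rewrite -(@integral_step R 1 a b)//; last by lra.
apply: ge0_le_integral_setT => s; first by rewrite step_ge0.
rewrite {1}/step indicE; case: (boolP (s \in _)) => [|_]; last first.
  by rewrite mulr0 mule_ge0 ?slab_vol_ge0 ?step_ge0.
rewrite inE/= in_itv/= => /h[h1 h2].
by rewrite /step indicE mem_set ?mulr1 ?mul1e ?IH//= in_itv.
Qed.

Lemma slab_vol_le (R : realType) (k : nat) (t : R) : (slab_vol k t <= (2 ^+ k)%:E)%E.
Proof.
elim: k t => [|k IH] t; first by rewrite slab_vol0 lee_fin; case: (_ <= _ <= _).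
by rewrite exprS; exact: slab_vol_le_double.
Qed.

Lemma slab_vol1_le (R : realType) (a t : R) : 0 <= a <= 2 -> a <= `|t| ->
  (slab_vol 1%N t <= (2 - a)%:E)%E.
Proof.
move=> ha hat; rewrite slab_volS.
have [x [y [xy h]]] : exists x y : R, y - x = 2 - a /\
    forall s, -1 <= s <= 1 -> -1 <= t + s <= 1 -> x <= s <= y.
  move: hat; have [t0|t0] := ger0P t => hat; [exists (-1), (1 - a)|exists (-1 + a), 1];
    split; try by lra.
    by move=> s; lra.
  by move=> s; lra.
rewrite -xy -[y - x]mul1r -(@integral_step R 1 x y)//; last by lra.
apply: ge0_le_integral_setT => s; first by rewrite mule_ge0 ?slab_vol_ge0// step_ge0.
rewrite slab_vol0 /step !mul1r !indicE -EFinM lee_fin -natrM ler_nat mulnb.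
have [/andP[]|//] := boolP (_ && _); rewrite inE/= in_itv/= => h1 h2.
by rewrite mem_set//= in_itv/=; exact: h.
Qed.

(** The volume of [slab 1 t] is 2 - |t| for |t| <= 2 and 0 beyond.  Bounding it by
    a decreasing step function of |t| with steps at 1/3 and 2/3 is precise
    enough (the exact maximum of [slab_vol 2] is 3). *)
Lemma slab_vol2_le (R : realType) (t : R) : (slab_vol 2%N t <= (10 / 3)%:E)%E.
Proof.
rewrite slab_volS.
pose f s := (step (4 / 3) (-1) 1 s + (step (1 / 3) (- t - 2 / 3) (- t + 2 / 3) s
   + step (1 / 3) (- t - 1 / 3) (- t + 1 / 3) s))%E.
have -> : (10 / 3)%:E = (\int[lebesgue_measure]_(s in setT) f s)%E.
  have n a b c : 0 <= c -> forall s, setT s -> (0 <= step c a b s)%E.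
    by move=> c0 s' _; exact: step_ge0.
  have m a b c := @measurable_step R a b c setT.
  rewrite ge0_integralD//; last 4 first.
  - by apply: n; lra.
  - exact: m.
  - by move=> s' _; rewrite adde_ge0 ?step_ge0//; lra.
  - by apply: emeasurable_funD; exact: m.
  rewrite ge0_integralD//; last 4 first.
  - by apply: n; lra.
  - exact: m.
  - by apply: n; lra.
  - exact: m.
  rewrite !integral_step; [|lra..].
  by rewrite -!EFinD; congr (_%:E); field.
apply: ge0_le_integral_setT => s; first by rewrite mule_ge0 ?slab_vol_ge0// step_ge0.
rewrite /f; have [hs|hs] := boolP (-1 <= s <= 1); last first.
  rewrite {1}/step indicE memNset/= ?in_itv/= ?mulr0 ?mul0e; last exact/negP.
  by apply: adde_ge0; [|apply: adde_ge0]; apply: step_ge0; lra.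
rewrite {1 2}/step !indicE mem_set/= ?in_itv// !mulr1 mul1e.
have W2 := slab_vol_le 1%N (t + s).
have W1 := @slab_vol1_le R (1 / 3) (t + s); have W0 := @slab_vol1_le R (2 / 3) (t + s).
have [h1|h1] := lerP (2 / 3) `|t + s|.
  apply: (le_trans (W0 _ h1)); first by lra.
  rewrite -[leLHS]adde0; apply: leeD; first by rewrite lee_fin; lra.
  by apply: adde_ge0; apply: step_ge0; lra.
have s1 : s \in (`[- t - 2 / 3, - t + 2 / 3]%classic : set R).
  by rewrite inE/= in_itv/=; move: h1; rewrite ltr_norml; lra.
rewrite {1}/step indicE s1 mulr1.
have [h2|h2] := lerP (1 / 3) `|t + s|.
  apply: (le_trans (W1 _ h2)); first by lra.
  rewrite addeA -[leLHS]adde0; apply: leeD; first by rewrite -EFinD lee_fin; lra.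
  by apply: step_ge0; lra.
have s2 : s \in (`[- t - 1 / 3, - t + 1 / 3]%classic : set R).
  by rewrite inE/= in_itv/=; move: h2; rewrite ltr_norml; lra.
by rewrite {1}/step indicE s2 mulr1 (le_trans W2)// -!EFinD lee_fin; lra.
Qed.

(** A convolution with a probability density does not increase the supremum. *)
Lemma slab_vol_le_five_sixths (R : realType) (k : nat) (t : R) :
  (slab_vol k.+2 t <= (5 / 6 * 2 ^+ k.+2)%:E)%E.
Proof.
elim: k t => [|k IH] t.
  by apply: (le_trans (slab_vol2_le t)); rewrite lee_fin; lra.
by rewrite exprS mulrCA; exact: slab_vol_le_double.
Qed.

(** The two factorizations of the same block matrix compute its determinant by
    either Schur complement. *)
Lemma det_rank_one_update (R : comUnitRingType) (k : nat) (u : 'cV[R]_k) (v : 'rV[R]_k) :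
  \det (1%:M + u *m v) = 1 + (v *m u) 0 0.
Proof.
have E1 : block_mx (1%:M + u *m v) u 0 1%:M *m block_mx 1%:M 0 (- v) 1%:M
   = block_mx 1%:M u (- v) (1%:M : 'M[R]_1).
  by rewrite mulmx_block !mulmx1 !mul0mx !mul1mx !mulmx0 !add0r mulmxN addrK.
have E2 : block_mx 1%:M 0 (- v) 1%:M *m block_mx 1%:M u 0 (1%:M + v *m u)
   = block_mx 1%:M u (- v) (1%:M : 'M[R]_1).
  by rewrite mulmx_block !mul1mx !mulmx1 !mul0mx !addr0 mulNmx addrC addrK.
have := congr1 determinant (etrans E1 (esym E2)).
rewrite !det_mulmx !det_lblock !det_ublock !det1 !mulr1 !mul1r => ->.
by rewrite [_ + _]mx11_scalar det_scalar1 mxE mxE eqxx.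
Qed.

Lemma det_hyperplane_gram (R : realType) (k : nat) :
  \det (hyperplane_basis R k.+1 *m (hyperplane_basis R k.+1)^T) = k.+1%:R.
Proof.
have -> : hyperplane_basis R k.+1 *m (hyperplane_basis R k.+1)^T =
    1%:M + (const_mx 1 : 'cV[R]_k) *m (const_mx 1 : 'rV[R]_k).
  apply/matrixP => i j; rewrite !mxE big_ord1 !mxE mulr1 big_ord_recr /=.
  rewrite !mxE eqxx !(gtn_eqF (ltn_ord _)) !sub0r mulrNN mulr1; congr (_ + _).
  rewrite (bigD1 i)//= big1 => [|l li]; last first.
    by rewrite !mxE /= [l == i :> nat](negbTE li) (ltn_eqF (ltn_ord l)) subrr mul0r.
  by rewrite !mxE/= eqxx (ltn_eqF (ltn_ord i)) !subr0 mul1r addr0.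
rewrite det_rank_one_update mxE (eq_bigr (fun=> 1)); last by move=> i _; rewrite !mxE mulr1.
by rewrite sumr_const card_ord -[1 in LHS]/(1%:R) -natrD add1n.
Qed.

(** The Gram determinant of the basis is d, and its square root cancels the
    sqrt d in the definition of K. *)
Lemma K_constE (R : realType) (k : nat) :
  K_const R k.+1 = (2 ^+ k)^-1 * fine (slab_vol k (0 : R)).
Proof.
rewrite /K_const /hyperplane_vol /subspace_vol det_hyperplane_gram /=.
have -> : [set u | cube_section (u *m hyperplane_basis R k.+1)] = slab k (0 : R).
  have wid (u : 'rV[R]_k) (i : 'I_k) : (u *m hyperplane_basis R k.+1) 0 (widen_ord (leqnSn k) i) = u 0 i.
    rewrite mxE (bigD1 i)//= big1 => [|l li].
      by rewrite !mxE /= eqxx (ltn_eqF (ltn_ord i)) subr0 mulr1 addr0.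
    by rewrite !mxE /= eq_sym [l == i :> nat](negbTE li) (ltn_eqF (ltn_ord i)) subrr mulr0.
  have mx (u : 'rV[R]_k) : (u *m hyperplane_basis R k.+1) 0 ord_max = - \sum_i u 0 i.
    rewrite mxE -sumrN; apply: eq_bigr => i _.
    by rewrite !mxE/= eqxx (gtn_eqF (ltn_ord i)) sub0r mulrN1.
  apply/seteqP; split => u /=.
    move=> [h1 _]; split; first by move=> i; rewrite -wid.
    by have := h1 ord_max; rewrite mx add0r; lra.
  move=> [h1 h2]; split.
    move=> i; have [j ->|->] := unliftP ord_max i.
      rewrite (_ : lift _ _ = widen_ord (leqnSn k) j) ?wid//.
      by apply: val_inj; rewrite /= /bump leqNgt ltn_ord.
    by rewrite mx; move: h2; rewrite add0r; lra.
  rewrite big_ord_recr /= mx; under eq_bigr do rewrite wid.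
  exact: subrr.
rewrite fineM//; last first.
  rewrite ge0_fin_numE ?lebesgue_rV_ge0//.
  by apply: le_lt_trans (slab_vol_le k 0) _; rewrite ltry.
rewrite /= invfM -mulrA mulKf// sqrtr_eq0 -ltNge ltr0Sn //.
Qed.

Lemma K_const_gt0 (R : realType) (k : nat) : 0 < K_const R k.+1.
Proof.
rewrite K_constE mulr_gt0 ?invr_gt0 ?exprn_gt0//.
have h1 : (1 <= slab_vol k (0 : R))%E by apply: slab_vol_ge1; lra.
have h2 := slab_vol_le k (0 : R).
rewrite fine_gt0// (lt_le_trans _ h1) ?lte_fin//=.
by apply: le_lt_trans h2 _; rewrite ltry.
Qed.

Lemma K_const_le (R : realType) (k : nat) (c : R) :
  (slab_vol k (0 : R) <= (c * 2 ^+ k)%:E)%E -> K_const R k.+1 <= c.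
Proof.
move=> h; rewrite K_constE mulrC ler_pdivrMr ?exprn_gt0//.
rewrite -lee_fin fineK// ge0_fin_numE ?lebesgue_rV_ge0//.
by apply: le_lt_trans h _; rewrite ltry.
Qed.

(** * Transference and the gap in the best approximations *)

Lemma int_dist_le (R : realType) (a : R) (z : int) : int_dist a <= `|a - z%:~R|.
Proof.
apply: ge_inf; last by exists z.
by exists 0 => _ [w _ <-].
Qed.

Lemma int_dist_ge0 (R : realType) (a : R) : 0 <= int_dist a.
Proof. by apply: lb_le_inf; [exists `|a - 0%:~R|, 0|move=> _ [w _ <-]]. Qed.

Lemma int_dist_attained (R : realType) (a : R) :
  exists z : int, int_dist a = `|a - z%:~R|.
Proof.
have [z hz] := near_int a; exists z; apply/eqP; rewrite eq_le int_dist_le /=.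
apply: lb_le_inf; first by exists `|a - z%:~R|, z.
move=> _ [w _ <-]; rewrite [leLHS]distrC; have [->|wz] := eqVneq w z.
  by rewrite distrC.
have : (1 : R) <= `|w%:~R - z%:~R|.
  by rewrite -intrB -intr_norm -[1]/(1%:~R) ler_int -gtz0_ge1 normr_gt0 subr_eq0.
have := ler_distD a w%:~R z%:~R; rewrite [`|a - z%:~R|]distrC [`|w%:~R - a|]distrC.
lra.
Qed.

Lemma approx_error_ge (R : realType) (k l : nat) (A : 'M[R]_(k, l)) (eta : 'rV[R]_k)
    (x : 'rV[int]_l) (j : 'I_k) :
  int_dist (lin_form A x j - eta 0 j) <= approx_error A eta x.
Proof. exact: (le_bigmax _ (fun j => int_dist (lin_form A x j - eta 0 j))). Qed.

Lemma approx_error_ge0 (R : realType) (k l : nat) (A : 'M[R]_(k, l))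
    (eta : 'rV[R]_k) (x : 'rV[int]_l) : 0 <= approx_error A eta x.
Proof. by rewrite /approx_error bigmax_idl le_max lexx. Qed.

Lemma le_sup_norm (R : realType) (l : nat) (x : 'rV[int]_l) (i : 'I_l) :
  `|(x 0 i)%:~R| <= (sup_norm x)%:R :> R.
Proof.
rewrite -intr_norm -natr_absz ler_nat.
exact: (@leq_bigmax _ (fun i => `|x 0%R i|%N) i).
Qed.

Lemma sup_norm_gt0 (l : nat) (x : 'rV[int]_l) : (0 < sup_norm x)%N = (x != 0).
Proof.
apply/idP/idP.
  by apply: contraTneq => ->; rewrite /sup_norm big1// => i _; rewrite mxE.
apply: contraNT; rewrite -leqNgt leqn0 => /eqP x0.
apply/eqP/rowP => i; rewrite mxE; apply/eqP; rewrite -absz_eq0 -leqn0.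
by have := @leq_bigmax _ (fun i => `|x 0%R i|%N) i; rewrite -/(sup_norm x) x0.
Qed.

(** With p_j and q_i the integers nearest to L_j(x) - eta_j and TL_i(y), replace
    both forms by their distances in
      sum_j y_j L_j(x) = sum_i x_i TL_i(y). *)
Lemma int_dist_transference (R : realType) (m n : nat) (Theta : 'M[R]_(n, m))
    (eta : 'rV[R]_n) (x : 'rV[int]_m) (y : 'rV[int]_n) :
  int_dist (\sum_(j < n) eta 0 j * (y 0 j)%:~R) <=
    n%:R * approx_error Theta eta x * (sup_norm y)%:R +
    m%:R * (sup_norm x)%:R * approx_error Theta^T 0 y.
Proof.
have /fin_all_exists [p hp] j := int_dist_attained (lin_form Theta x j - eta 0 j).
have /fin_all_exists [q hq] i := int_dist_attained (lin_form Theta^T y i - (0 : 'rV[R]_m) 0 i).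
pose rho j := lin_form Theta x j - eta 0 j - (p j)%:~R.
pose zeta i := lin_form Theta^T y i - (0 : 'rV[R]_m) 0 i - (q i)%:~R.
pose z : int := \sum_i x 0 i * q i - \sum_j y 0 j * p j.
have E : \sum_(j < n) eta 0 j * (y 0 j)%:~R - z%:~R =
    \sum_i (x 0 i)%:~R * zeta i - \sum_j (y 0 j)%:~R * rho j.
  have swap : \sum_(j < n) (y 0 j)%:~R * lin_form Theta x j =
      \sum_(i < m) (x 0 i)%:~R * lin_form Theta^T y i.
    under eq_bigr do rewrite mulr_sumr; rewrite exchange_big /=.
    apply: eq_bigr => i _; rewrite mulr_sumr; apply: eq_bigr => j _.
    by rewrite mxE; ring.
  rewrite /z intrB !rmorph_sum /=.
  have -> : \sum_i (x 0 i)%:~R * zeta i = \sum_(i < m) (x 0 i)%:~R * lin_form Theta^T y i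
      - \sum_(i < m) (x 0 i * q i)%:~R.
    rewrite -sumrB; apply: eq_bigr => i _; rewrite /zeta mxE rmorphM /=; ring.
  have -> : \sum_j (y 0 j)%:~R * rho j = \sum_(j < n) (y 0 j)%:~R * lin_form Theta x j
      - \sum_(j < n) eta 0 j * (y 0 j)%:~R - \sum_(j < n) (y 0 j * p j)%:~R.
    rewrite -!sumrB; apply: eq_bigr => i _; rewrite /rho rmorphM /=; ring.
  rewrite swap; ring.
apply: (le_trans (int_dist_le _ z)); rewrite E; apply: (le_trans (ler_normB _ _)).
rewrite addrC; apply: lerD; apply: (le_trans (ler_norm_sum _ _ _)).
  apply: (@le_trans _ _ (\sum_(j < n) approx_error Theta eta x * (sup_norm y)%:R)).
    apply: ler_sum => j _; rewrite normrM mulrC ler_pM// ?le_sup_norm//.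
    by rewrite /rho -hp approx_error_ge.
  by rewrite sumr_const card_ord -[leLHS]mulr_natl mulrA.
apply: (@le_trans _ _ (\sum_(i < m) (sup_norm x)%:R * approx_error Theta^T 0 y)).
  apply: ler_sum => i _; rewrite normrM ler_pM// ?le_sup_norm//.
  by rewrite /zeta -hq approx_error_ge.
by rewrite sumr_const card_ord -[leLHS]mulr_natl mulrA.
Qed.

Lemma irrationality_fun_le (R : realType) (k l : nat) (A : 'M[R]_(k, l)) (t : R)
    (y : 'rV[int]_l) : y != 0 -> (sup_norm y)%:R <= t ->
  irrationality_fun A t <= approx_error A 0 y.
Proof.
move=> y0 yt; apply: ge_inf; last by exists y; rewrite //= sup_norm_gt0.
by exists 0 => _ [z _ <-]; exact: approx_error_ge0.
Qed.

(** The witness is the last index nu with Y_nu <= |z|: it exists because the Y_nu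
    increase, and zeta_nu is then the minimal error up to |z|. *)
Lemma best_approximation_below (R : realType) (k l : nat) (A : 'M[R]_(k, l))
    (last : option nat) (y : nat -> 'rV[int]_l) (z : 'rV[int]_l) :
  best_approximations A last y -> z != 0 ->
  exists nu, [/\ indices last nu, (sup_norm (y nu) <= sup_norm z)%N &
                 approx_error A 0 (y nu) <= approx_error A 0 z].
Proof.
move=> [_ Y0 Ystep zeta0 Ylast] z0.
have sz : (0 < sup_norm z)%N by rewrite sup_norm_gt0.
have Ygrow nu : indices last nu -> (nu < sup_norm (y nu))%N.
  elim: nu => [|nu IH] hnu; first by rewrite Y0.
  have [Ylt _ _] := Ystep _ hnu; apply: leq_ltn_trans Ylt; apply: IH.
  by move: hnu; rewrite /indices /=; case: (last) => // N; exact: ltnW.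
pose P nu := `[< indices last nu >] && (sup_norm (y nu) <= sup_norm z)%N.
have exP : exists nu, P nu.
  exists 0%N; rewrite /P Y0 sz andbT; apply/asboolP.
  by rewrite /indices /=; case: (last).
have bP nu : P nu -> (nu <= sup_norm z)%N.
  by move=> /andP[/asboolP/Ygrow h1 h2]; rewrite ltnW// (leq_trans h1).
have [nu /andP[/asboolP hnu Yz] numax] := ex_maxnP exP bP.
exists nu; split => //.
have [lnu|lnu] := pselect (last = Some nu).
  by have /(_ hnu)[_ ->//] := zeta0 nu; exact: approx_error_ge0.
have hnu1 : indices last nu.+1.
  move: hnu lnu; rewrite /indices /=; case: (last) => // N.
  by rewrite leq_eqVlt => /predU1P[->|].
have [_ _ psiE] := Ystep _ hnu1.
rewrite -(psiE (sup_norm z)%:R) ?irrationality_fun_le ?ler_nat// ltr_nat ltnNge.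
apply/negP => h; have : (nu.+1 <= nu)%N by apply: numax; rewrite /P h andbT; exact/asboolP.
by rewrite ltnn.
Qed.

Definition gap (R : realType) (k l : nat) (A : 'M[R]_(k, l)) (U V : R) : Prop :=
  forall y : 'rV[int]_l, y != 0 -> (sup_norm y)%:R <= U -> V <= approx_error A 0 y.

Lemma gap_of_shift (R : realType) (m n : nat) (Theta : 'M[R]_(n, m))
    (last : option nat) (y : nat -> 'rV[int]_n) (eta : 'rV[R]_n) (eps rho U V : R)
    (x : 'rV[int]_m) :
  (0 < m)%N -> x != 0 -> best_approximations Theta^T last y ->
  eps <= inf_dist last y eta -> approx_error Theta eta x <= rho ->
  n%:R * rho * U + m%:R * (sup_norm x)%:R * V <= eps -> gap Theta^T U V.
Proof.
move=> m0 x0 best_y le_eps err_le UV z z0 zU; rewrite leNgt; apply/negP => zV.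
have [nu [hnu Yz errz]] := best_approximation_below best_y z0.
have h1 : eps <= int_dist (\sum_(j < n) eta 0 j * (y nu 0 j)%:~R).
  apply: (le_trans le_eps); apply: ge_inf; last by exists nu.
  by exists 0 => _ [k _ <-]; exact: int_dist_ge0.
have h2 := int_dist_transference Theta eta x (y nu).
have rho0 : 0 <= rho by exact: le_trans (approx_error_ge0 _ _ _) err_le.
have h3 : n%:R * approx_error Theta eta x * (sup_norm (y nu))%:R <= n%:R * rho * U.
  rewrite ler_pM ?mulr_ge0 ?approx_error_ge0 ?ler_wpM2l//.
  by apply: le_trans zU; rewrite ler_nat.
have h4 : m%:R * (sup_norm x)%:R * approx_error Theta^T 0 (y nu) <
    m%:R * (sup_norm x)%:R * V.
  rewrite ltr_pM2l; first exact: le_lt_trans zV.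
  by rewrite mulr_gt0 ?ltr0n ?sup_norm_gt0.
lra.
Qed.

(** Dirichlet's argument: at least U^l integer points of the cube
    [0, U]^l are sorted into N^k boxes of side 1 / N < V by the fractional
    parts of the forms, with N <= 1 / V + 1.  Two points in one box would
    differ by a point violating the gap. *)
Lemma gap_volume_le (R : realType) (k l : nat) (A : 'M[R]_(k, l)) (U V : R) :
  0 < U -> 0 < V -> gap A U V -> U ^+ l * V ^+ k <= (1 + V) ^+ k.
Proof.
move=> U0 V0 hgap.
set M := (Num.trunc U).+1; set N := (Num.trunc V^-1).+1.
have UM : U < M%:R by exact: truncnS_gt.
have MU : (Num.trunc U)%:R <= U by rewrite truncn_le ltW.
have NV : V^-1 < N%:R by exact: truncnS_gt.
have VN : N%:R <= V^-1 + 1.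
  by rewrite -natr1 lerD2r truncn_le ltW// invr_gt0.
have N0 : 0 < N%:R :> R by rewrite ltr0n.
pose vec (f : {ffun 'I_l -> 'I_M}) : 'rV[int]_l := \row_j (f j : nat)%:Z.
pose frac (a : R) := a - (Num.floor a)%:~R.
have frac0 a : 0 <= frac a by rewrite subr_ge0 floor_le.
have frac1 a : frac a < 1 by rewrite ltrBlDl -intrD1 floorD1_gt.
have boxP a : (Num.trunc (N%:R * frac a) < N)%N.
  by rewrite truncn_lt_nat ?mulr_ge0// gtr_pMr.
pose box f : {ffun 'I_k -> 'I_N} := [ffun i => Ordinal (boxP (lin_form A (vec f) i))].
have box_inj : injective box.
  move=> f g fg; apply/ffunP => j; apply: val_inj => /=; apply/eqP.
  apply: contraTT isT => fgj.
  have d0 : vec f - vec g != 0.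
    apply: contraNneq fgj => /rowP/(_ j); rewrite !mxE => /eqP.
    by rewrite subr_eq0.
  have dU : (sup_norm (vec f - vec g))%:R <= U.
    apply: le_trans MU; rewrite ler_nat; apply/bigmax_leqP => i _.
    by rewrite !mxE; have := ltn_ord (f i); have := ltn_ord (g i); rewrite /M; lia.
  suff : approx_error A 0 (vec f - vec g) < V by rewrite ltNge hgap.
  apply: bigmax_lt => // i _.
  have linB : lin_form A (vec f - vec g) i = lin_form A (vec f) i - lin_form A (vec g) i.
    rewrite /lin_form -sumrB; apply: eq_bigr => h _.
    by rewrite [(vec f - vec g) 0 h]mxE [(- vec g) 0 h]mxE intrB mulrBr.
  set a := lin_form A (vec f) i in linB *; set b := lin_form A (vec g) i in linB *.
  have tE : Num.trunc (N%:R * frac a) = Num.trunc (N%:R * frac b).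
    by have /ffunP/(_ i) := fg; rewrite !ffunE => /(congr1 val).
  have ha := @truncn_itv R (N%:R * frac a); have hb := @truncn_itv R (N%:R * frac b).
  have /ha/andP[ha1 ha2] : 0 <= N%:R * frac a by rewrite mulr_ge0.
  have /hb/andP[hb1 hb2] : 0 <= N%:R * frac b by rewrite mulr_ge0.
  rewrite tE in ha1 ha2.
  apply: (le_lt_trans (int_dist_le _ (Num.floor a - Num.floor b))).
  rewrite linB mxE subr0 intrB.
  have -> : a - b - ((Num.floor a)%:~R - (Num.floor b)%:~R) = frac a - frac b.
    by rewrite /frac; ring.
  have : `|N%:R * frac a - N%:R * frac b| < 1.
    by rewrite -natr1 in ha2 hb2; rewrite ltr_norml; lra.
  rewrite -mulrBr normrM gtr0_norm// -ltr_pdivlMl// mulr1 => /lt_trans; apply.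
  by rewrite -[V]invrK ltf_pV2 ?posrE ?invr_gt0.
have := leq_card _ box_inj; rewrite !card_ffun !card_ord -(ler_nat R) !natrX => MN.
have UMl : U ^+ l <= M%:R ^+ l by rewrite lerXn2r ?nnegrE// ltW.
apply: (@le_trans _ _ (N%:R ^+ k * V ^+ k)).
  by rewrite ler_wpM2r ?exprn_ge0 ?(ltW V0)// (le_trans UMl).
rewrite -exprMn lerXn2r ?nnegrE ?mulr_ge0 ?addr_ge0 ?(ltW V0)//.
by move: (ler_wpM2r (ltW V0) VN); rewrite mulrDl mulVf ?gt_eqF// mul1r.
Qed.

(** * From a gap to inhomogeneous approximations *)

Lemma sqnorm_ge_coord (R : realType) (N : nat) (v : 'rV[R]_N) (i : 'I_N) (a : R) :
  0 <= a -> a <= `|v 0 i| -> a ^+ 2 <= sqnorm v.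
Proof.
move=> a0 h; rewrite sqnormE (bigD1 i)//= -[a ^+ 2]addr0 lerD//.
  by rewrite -[leRHS]real_normK ?num_real// lerXn2r ?nnegrE.
by apply: sumr_ge0 => j _; exact: sqr_ge0.
Qed.

Lemma lin_formE (R : realType) (k l : nat) (A : 'M[R]_(k, l)) (x : 'rV[int]_l) (j : 'I_k) :
  lin_form A x j = (intv x *m A^T) 0 j.
Proof. by rewrite mxE; apply: eq_bigr => i _; rewrite !mxE mulrC. Qed.

(** The gap says that the form (|y| / U)^2 + (|y Theta - z| / V)^2, given by the
    block matrix P, is at least 1 on nonzero integer vectors (y, z), where
    |.| is the Euclidean norm.  The integer form w = (p, x) supplied by
    [dual_covering] is then tested on two families of real vectors: those
    with y = 0 isolate the coordinates of x - c, and those with z = y Theta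
    isolate L(x) - alpha + p. *)
Lemma inhomogeneous_of_gap (R : realType) (m n : nat) (Theta : 'M[R]_(n, m)) (U V sigma : R)
    (alpha : 'rV[R]_n) (c : 'rV[R]_m) :
  0 < U -> 0 < V <= 1 -> gap Theta^T U V ->
  0 <= sigma -> covering_const R (n + m) <= sigma ^+ 2 ->
  exists x : 'rV[int]_m, (forall i, `|(x 0 i)%:~R - c 0 i| <= sigma / V) /\
    approx_error Theta alpha x <= sigma / U.
Proof.
move=> U0 /andP[V0 V1] hgap s0 hs.
pose P := block_mx (U^-1)%:M (V^-1 *: Theta) 0 (- V^-1)%:M : 'M[R]_(n + m).
have PE (y : 'rV[R]_n) (z : 'rV[R]_m) : row_mx y z *m P =
    row_mx (U^-1 *: y) (V^-1 *: (y *m Theta - z)).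
  rewrite mul_row_block mulmx0 addr0 !mul_mx_scalar -scalemxAr.
  by rewrite scaleNr -scalerBr.
have V_ge1 : 1 <= V^-1 by rewrite invf_ge1.
have hP (u : 'rV[int]_(n + m)) : u != 0 -> 1 <= sqnorm (intv u *m P).
  rewrite -[u]hsubmxK; set y := lsubmx u; set z := rsubmx u => u0.
  rewrite map_row_mx PE -[leLHS](expr1n _ 2).
  have [y0|y0] := eqVneq y 0.
    have : z != 0 by apply: contraNneq u0 => ->; rewrite y0 row_mx0.
    case/rV0Pn => i zi; apply: (@sqnorm_ge_coord _ _ _ (rshift n i)) => //.
    rewrite row_mxEr y0 map_mx0 mul0mx sub0r !mxE normrM normrN gtr0_norm ?invr_gt0//.
    rewrite mulr_ege1// -intr_norm -[1]/(1%:~R) ler_int.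
    by move: zi; rewrite /z mxE -gtz0_ge1 normr_gt0.
  have [yU|Uy] := leP (sup_norm y)%:R U.
    have := hgap _ y0 yU.
    have [/existsP[i hi] _|/existsPn nh] :=
        boolP [exists i, V <= int_dist (lin_form Theta^T y i - (0 : 'rV[R]_m) 0 i)].
      apply: (@sqnorm_ge_coord _ _ _ (rshift n i)) => //.
      rewrite row_mxEr mxE normrM gtr0_norm ?invr_gt0// -ler_pdivrMl ?invr_gt0// invrK mulr1.
      apply: (le_trans hi); apply: le_trans (int_dist_le _ (z 0 i)) _.
      by rewrite lin_formE trmxK !mxE subr0.
    by rewrite leNgt => /negP[]; apply: bigmax_lt => // i _; rewrite ltNge nh.
  have [/existsP[i hi]|/existsPn nh] := boolP [exists i, U <= `|(y 0 i)%:~R|].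
    apply: (@sqnorm_ge_coord _ _ _ (lshift m i)) => //.
    rewrite row_mxEl 2!mxE normrM gtr0_norm ?invr_gt0// -ler_pdivrMl ?invr_gt0//.
    by rewrite invrK mulr1.
  have : (sup_norm y)%:R <= U.
    rewrite -truncn_ge_nat ?(ltW U0)//; apply/bigmax_leqP => i _.
    rewrite truncn_ge_nat ?(ltW U0)// natr_absz intr_norm ltW//.
    by rewrite ltNge nh.
  by rewrite leNgt Uy.
have [w hw] := dual_covering ltr01 hP (row_mx (alpha - c *m Theta^T) c).
set p := lsubmx w; set x := rsubmx w.
have {}hw y z : (((intv p - (alpha - c *m Theta^T)) *m y^T) 0 0 +
     ((intv x - c) *m z^T) 0 0) ^+ 2 <=
   sigma ^+ 2 * sqnorm (row_mx (U^-1 *: y) (V^-1 *: (y *m Theta - z))).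
  have := hw (row_mx y z); rewrite PE divr1 -[w]hsubmxK map_row_mx opp_row_mx.
  rewrite add_row_mx tr_row_mx mul_row_col mxE => /le_trans; apply.
  by rewrite ler_wpM2r ?sqnorm_ge0.
have coordE N (A : 'rV[R]_N) i : (A *m (delta_mx 0 i)^T) 0 0 = A 0 i.
  rewrite mxE (bigD1 i)//= big1 => [|j ji].
    by rewrite !mxE !eqxx mulr1 addr0.
  by rewrite !mxE (negbTE ji) andbF mulr0.
have sq_delta N i : sqnorm (delta_mx 0 i : 'rV[R]_N) = 1.
  by rewrite /sqnorm coordE mxE !eqxx.
have sq_row N M (A : 'rV[R]_N) (B : 'rV[R]_M) : sqnorm (row_mx A B) = sqnorm A + sqnorm B.
  by rewrite /sqnorm tr_row_mx mul_row_col mxE.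
have root a b : 0 <= b -> a ^+ 2 <= sigma ^+ 2 * b ^+ 2 -> `|a| <= sigma * b.
  move=> b0; rewrite -exprMn -real_normK ?num_real//.
  by rewrite ler_pXn2r ?nnegrE ?mulr_ge0.
exists x; split => [i|].
  apply: root; first by rewrite invr_ge0 ltW.
  have := hw 0 (delta_mx 0 i); rewrite trmx0 mulmx0 mxE add0r coordE.
  rewrite !mxE mul0mx sub0r scaler0 scalerN -scaleNr sq_row sqnormZ sq_delta.
  by rewrite /sqnorm mul0mx mxE add0r mulr1 sqrrN.
apply: bigmax_le => [|j _]; first by rewrite divr_ge0// ltW.
apply: (le_trans (int_dist_le _ (- p 0 j))); apply: root; first by rewrite invr_ge0 ltW.
have := hw (delta_mx 0 j) (delta_mx 0 j *m Theta).
rewrite coordE trmx_mul mulmxA coordE subrr scaler0 sq_row sqnormZ sq_delta.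
rewrite /sqnorm mul0mx [X in _ * (_ + X)]mxE addr0 mulr1.
congr (_ ^+ 2 <= _).
rewrite lin_formE mulmxBl rmorphN opprK /= !mxE.
by ring.
Qed.

Lemma nth_root_exists (R : realType) (n : nat) (a : R) : (0 < n)%N -> 0 <= a ->
  exists2 b : R, 0 <= b & b ^+ n = a.
Proof.
move=> n0 a0; exists (a `^ n%:R^-1); first exact: powR_ge0.
by rewrite -powR_mulrn ?powR_ge0// -powRrM mulVf ?powRr1// pnatr_eq0 -lt0n.
Qed.

(** Far-out points x come from a box centred at (t, ..., t) with
    t = sigma / V + N, where sigma^2 = c_(n+m).  Then N <= x_i <= 2 sigma / V + N,
    and the slack s - sigma absorbs N once V is small. *)
Lemma approx_liminf_le (R : realType) (m n : nat) (Theta : 'M[R]_(n, m)) (alpha : 'rV[R]_n)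
    (s B : R) :
  (0 < m)%N -> 0 < s -> covering_const R (n + m) < s ^+ 2 ->
  (forall V0, 0 < V0 -> exists U V,
     [/\ 0 < U, 0 < V < V0, gap Theta^T U V & (U ^+ n * V ^+ m)^-1 = B]) ->
  (approx_liminf Theta alpha <= ((2 * s) ^+ (m + n) * B)%:E)%E.
Proof.
move=> m0 s0 hs hUV; apply: ge_ereal_sup => _ [N _ <-].
pose sigma := Num.sqrt (covering_const R (n + m)).
have sigma0 : 0 <= sigma by exact: sqrtr_ge0.
have sigma2 : sigma ^+ 2 = covering_const R (n + m).
  by rewrite sqr_sqrtr ?covering_const_ge0.
have le_sigma : covering_const R (n + m) <= sigma ^+ 2 by rewrite sigma2.
have sigma_s : sigma < s.
  by rewrite -(@ltr_pXn2r _ 2) ?nnegrE ?sigma2// ltW.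
pose V0 := Num.min 1 (2 * (s - sigma) / N.+1%:R).
have V00 : 0 < V0 by rewrite lt_min ltr01 divr_gt0// mulr_gt0// subr_gt0.
have [U [V [U0 /andP[Vgt0 ltV] hgap UVB]]] := hUV _ V00.
move: ltV; rewrite lt_min => /andP[V1 VN].
have V01 : 0 < V <= 1 by rewrite Vgt0 ltW.
have [x [xc err]] := inhomogeneous_of_gap alpha (const_mx (sigma / V + N%:R))
  U0 V01 hgap sigma0 le_sigma.
have xN i : N%:R <= (x 0 i)%:~R :> R.
  by have := xc i; rewrite mxE ler_norml; lra.
have xs i : `|(x 0 i)%:~R : R| <= 2 * s / V.
  rewrite ger0_norm ?(le_trans _ (xN i))//.
  have NV : N%:R <= 2 * (s - sigma) / V.
    rewrite ler_pdivlMr//; apply: (@le_trans _ _ (N.+1%:R * V)).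
      by rewrite ler_wpM2r ?ler_nat// ltW.
    by rewrite mulrC -ler_pdivlMr// ltW.
  have := xc i; rewrite mxE ler_norml => /andP[_].
  have -> : 2 * s / V = 2 * (s - sigma) / V + 2 * (sigma / V) by ring.
  lra.
have sV0 : 0 <= 2 * s / V by rewrite divr_ge0 ?mulr_ge0 ?(ltW s0) ?(ltW Vgt0).
have supx : (sup_norm x)%:R <= 2 * s / V.
  rewrite -truncn_ge_nat//; apply/bigmax_leqP => i _.
  by rewrite truncn_ge_nat// natr_absz intr_norm.
apply: (@le_trans _ _ (approx_error Theta alpha x ^+ n * (sup_norm x)%:R ^+ m)%:E).
  apply: ereal_inf_lbound; exists x => //=.
  rewrite -(ler_nat R); apply: (le_trans (xN (Ordinal m0))).
  by apply: le_trans (le_sup_norm R x (Ordinal m0)); rewrite ler_norm.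
rewrite lee_fin.
have -> : (2 * s) ^+ (m + n) * B = (2 * s / U) ^+ n * (2 * s / V) ^+ m.
  by rewrite -UVB !exprMn !exprVn !exprD invfM; ring.
rewrite ler_pM ?exprn_ge0 ?approx_error_ge0// lerXn2r ?nnegrE ?approx_error_ge0//.
  by rewrite divr_ge0 ?mulr_ge0 ?(ltW s0) ?(ltW U0).
apply: (le_trans err); rewrite ler_wpM2r ?invr_ge0 ?(ltW U0)//; lra.
Qed.

(** Instead of rho = max_j ||L_j(x) - eta_j||, which may vanish, the larger
    number rho with rho^n X^m = D is used; then U^n V^m is the same for all x,
    and V -> 0 as |x| grows. *)
Lemma gaps_of_liminf_lt (R : realType) (m n : nat) (Theta : 'M[R]_(n, m))
    (last : option nat) (y : nat -> 'rV[int]_n) (eta : 'rV[R]_n) (eps D r V0 : R) :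
  (0 < m)%N -> (0 < n)%N -> best_approximations Theta^T last y ->
  0 < eps -> eps <= inf_dist last y eta ->
  0 < D -> (approx_liminf Theta eta < D%:E)%E -> 0 < r < 1 -> 0 < V0 ->
  exists U V, [/\ 0 < U, 0 < V < V0, gap Theta^T U V &
    (U ^+ n * V ^+ m)^-1 =
      (n%:R ^+ n * m%:R ^+ m) / eps ^+ (m + n) * D / (r ^+ n * (1 - r) ^+ m)].
Proof.
move=> m0 n0 best_y eps0 le_eps D0 liminfD /andP[r0 r1] V00.
have r10 : 0 < 1 - r by rewrite subr_gt0.
have mR : 0 < m%:R :> R by rewrite ltr0n.
have nR : 0 < n%:R :> R by rewrite ltr0n.
pose N := (Num.trunc ((1 - r) * eps / (m%:R * V0))).+1.
have hN : (1 - r) * eps / (m%:R * V0) < N%:R by exact: truncnS_gt.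
have [_ [x /= Nx <-] fx] : exists2 z : \bar R,
    [set (approx_error Theta eta x ^+ n * (sup_norm x)%:R ^+ m)%:E
      | x in [set x | (N <= sup_norm x)%N]] z & (z < D%:E)%E.
  apply: ereal_inf_lt; apply: le_lt_trans liminfD.
  by apply: ereal_sup_ubound; exists N.
rewrite lte_fin in fx.
have X_gt0 : (0 < sup_norm x)%N by exact: leq_trans Nx.
set X := (sup_norm x)%:R in fx.
have X0 : 0 < X by rewrite ltr0n.
have [|rho rho_ge0 rhoE] := @nth_root_exists R n (D / X ^+ m) n0.
  by rewrite divr_ge0 ?exprn_ge0 ?ltW.
have rho0 : 0 < rho.
  rewrite lt0r rho_ge0 andbT; apply: contraTneq D0 => rho_eq0.
  have : D / X ^+ m = 0 by rewrite -rhoE rho_eq0 expr0n gtn_eqF.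
  by move/eqP; rewrite mulf_eq0 invr_eq0 expf_eq0 (gt_eqF X0) andbF orbF => /eqP->; rewrite ltxx.
exists (r * eps / (n%:R * rho)), ((1 - r) * eps / (m%:R * X)); split.
- by rewrite divr_gt0 ?mulr_gt0.
- rewrite divr_gt0 ?mulr_gt0//= ltr_pdivrMr ?mulr_gt0//.
  move: hN; rewrite ltr_pdivrMr ?mulr_gt0// => /lt_le_trans; apply.
  have -> : V0 * (m%:R * X) = X * (m%:R * V0) by ring.
  by rewrite ler_wpM2r ?ler_nat// ltW// mulr_gt0.
- have x0 : x != 0 by rewrite -sup_norm_gt0.
  apply: (gap_of_shift m0 x0 best_y le_eps (rho := rho)).
    rewrite -(@ler_pXn2r _ n) ?nnegrE ?approx_error_ge0// rhoE ler_pdivlMr ?exprn_gt0//.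
    exact: ltW.
  rewrite -/X le_eqVlt; apply/orP; left; apply/eqP; field.
  by rewrite !gt_eqF.
- rewrite !expr_div_n !exprMn rhoE exprD; field.
  by rewrite !gt_eqF ?exprn_gt0.
Qed.

(** * The constants *)

(** For d >= 3 the inequality follows from K^2 <= 25/36 < 5/7, which compensates the
    growth (7/5)^d of the left side; for d = 2 it reads 3/5 < 1 / K^2. *)
Lemma covering_const_lt (R : realType) (k : nat) :
  covering_const R k.+2 < (k.+2%:R / (2 * K_const R k.+2 ^+ k.+1)) ^+ 2.
Proof.
have K0 := K_const_gt0 R k.+1.
suff h : 5 / 2 * ((7 / 5) ^+ k.+2 - 1) * (K_const R k.+2 ^+ 2) ^+ k.+1 < k.+2%:R ^+ 2.
  rewrite expr_div_n ltr_pdivlMr ?exprn_gt0 ?mulr_gt0 ?exprn_gt0//.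
  rewrite exprMn exprAC /covering_const; lra.
case: k => [|k] in K0 *.
  have K1 : K_const R 2 <= 1 by apply: K_const_le; rewrite mul1r slab_vol_le.
  have : K_const R 2 ^+ 2 <= 1 by rewrite exprn_ile1// ltW.
  rewrite expr1; move: (K_const R 2 ^+ 2) => x; lra.
have K1 : K_const R k.+3 <= 5 / 6 by apply: K_const_le; exact: slab_vol_le_five_sixths.
have K2 : K_const R k.+3 ^+ 2 <= 5 / 7.
  apply: (@le_trans _ _ ((5 / 6) ^+ 2)); last by lra.
  by rewrite lerXn2r ?nnegrE// ltW.
have K3 : (7 / 5 * K_const R k.+3 ^+ 2) ^+ k.+2 <= 1.
  have x0 := sqr_ge0 (K_const R k.+3).
  by apply: exprn_ile1; lra.
apply: (@le_lt_trans _ _ (7 / 2)); last first.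
  have : (3 : R) <= k.+3%:R by rewrite ler_nat.
  by rewrite expr2; move: (k.+3%:R) => t ht; nra.
rewrite exprMn in K3; rewrite [_ ^+ k.+3]exprS.
have K4 : 0 <= (K_const R k.+3 ^+ 2) ^+ k.+2 by rewrite exprn_ge0// sqr_ge0.
move: K3 K4; move: ((7 / 5) ^+ k.+2) ((_ ^+ 2) ^+ _) => a b; nra.
Qed.

Lemma le1_of_le_expr (R : realType) (a : R) (m : nat) :
  (forall V0, 0 < V0 -> exists2 V, 0 < V < V0 & a <= (1 + V) ^+ m) -> a <= 1.
Proof.
move=> h; rewrite leNgt; apply/negP => a1.
have lin (V : R) j : 0 <= V <= 1 -> (1 + V) ^+ j <= 1 + 3 ^+ j * V.
  move=> V01; elim: j => [|j IH]; first by rewrite !expr0 mul1r; lra.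
  have j1 : (1 : R) <= 3 ^+ j by rewrite exprn_ege1//; lra.
  rewrite !exprS; move: IH j1; move: ((1 + V) ^+ j) (3 ^+ j) => p q IH j1.
  have [V0 V1] := andP V01.
  have h1 : 0 <= (1 + V) * (1 + q * V - p) by rewrite mulr_ge0 ?subr_ge0//; lra.
  have h2 : 0 <= (q - 1) * V by rewrite mulr_ge0 ?subr_ge0.
  have h3 : 0 <= q * V * (1 - V) by rewrite !mulr_ge0 ?subr_ge0//; lra.
  lra.
have m0 : (0 : R) < 3 ^+ m by rewrite exprn_gt0//; lra.
have [|V /andP[V0]] := h (Num.min 1 ((a - 1) / 3 ^+ m)).
  by rewrite lt_min ltr01 divr_gt0// subr_gt0.
rewrite lt_min => /andP[V1]; rewrite ltr_pdivlMr// => aV le_a.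
have V01 : 0 <= V <= 1 by rewrite !ltW.
have := lin V m V01; lra.
Qed.

Lemma approx_liminf_ge0 (R : realType) (m n : nat) (Theta : 'M[R]_(n, m))
    (eta : 'rV[R]_n) : (0 <= approx_liminf Theta eta)%E.
Proof.
apply: (@le_trans _ _ (ereal_inf [set (approx_error Theta eta x ^+ n *
    (sup_norm x)%:R ^+ m)%:E | x in [set x : 'rV[int]_m | (0 <= sup_norm x)%N]])).
  apply: le_ereal_inf_tmp => _ [x _ <-].
  by rewrite lee_fin mulr_ge0 ?exprn_ge0 ?approx_error_ge0.
by apply: ereal_sup_ubound; exists 0%N.
Qed.

Lemma R_const_le (R : realType) (m n : nat) (c : R) :
  (forall r, 0 < r < 1 -> r ^+ n * (1 - r) ^+ m <= c) -> R_const R m n <= c.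
Proof.
move=> h; apply: ge_sup => [|_ [r /= hr <-]]; last exact: h.
by exists (2^-1 ^+ n * (1 - 2^-1) ^+ m), 2^-1 => //=; lra.
Qed.

Lemma R_const_gt0 (R : realType) (m n : nat) : 0 < R_const R m n.
Proof.
have h2 : (0 : R) < 1 - 2^-1 by lra.
apply: (@lt_le_trans _ _ (2^-1 ^+ n * (1 - 2^-1) ^+ m)).
  by rewrite mulr_gt0 ?exprn_gt0.
apply: ub_le_sup; last by exists 2^-1 => //=; lra.
exists 1 => _ [r /= hr <-].
by rewrite mulr_ile1 ?exprn_ge0 ?exprn_ile1//; lra.
Qed.

(** The bounds hold for all D' > Delta and 0 < r < 1 in place of Delta and the
    optimal r.  The limits are taken by letting e = D' - Delta tend to 0 and
    by passing to the supremum over r. *)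
Lemma liminf_bounds (R : realType) (m n : nat) (Theta : 'M[R]_(n, m))
    (last : option nat) (y : nat -> 'rV[int]_n) (eta alpha : 'rV[R]_n)
    (eps s D : R) :
  let B := (n%:R ^+ n * m%:R ^+ m) / eps ^+ (m + n) * D / R_const R m n in
  (0 < m)%N -> (0 < n)%N -> best_approximations Theta^T last y ->
  0 < eps -> eps <= inf_dist last y eta ->
  approx_liminf Theta eta = D%:E ->
  0 < s -> covering_const R (n + m) < s ^+ 2 ->
  1 <= B /\ (approx_liminf Theta alpha <= ((2 * s) ^+ (m + n) * B)%:E)%E.
Proof.
have half : 0 < (2^-1 : R) < 1 by rewrite invr_gt0 invf_lt1 ?ltr1n ?ltr0n.
set C := n%:R ^+ n * m%:R ^+ m / eps ^+ (m + n).
move=> B m0 n0 best_y eps0 le_eps limE s0 hs.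
have C0 : 0 < C by rewrite divr_gt0 ?mulr_gt0 ?exprn_gt0 ?ltr0n.
have D0 : 0 <= D by have := approx_liminf_ge0 Theta eta; rewrite limE.
have Rc0 := R_const_gt0 R m n.
have gaps e r : 0 < e -> 0 < r < 1 -> forall V0, 0 < V0 -> exists U V,
    [/\ 0 < U, 0 < V < V0, gap Theta^T U V &
     (U ^+ n * V ^+ m)^-1 = C * (D + e) / (r ^+ n * (1 - r) ^+ m)].
  move=> e0 hr V0 V00; apply: (gaps_of_liminf_lt (D := D + e) m0 n0 best_y eps0 le_eps) => //.
    by rewrite ltr_wpDl.
  by rewrite limE lte_fin ltrDl.
have prod_gt0 r : 0 < r < 1 -> 0 < r ^+ n * (1 - r) ^+ m.
  by move=> /andP[? ?]; rewrite mulr_gt0 ?exprn_gt0// subr_gt0.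
have De0 e : 0 < e -> 0 < C * (D + e) by move=> e0; rewrite mulr_gt0// ltr_wpDl.
have limit x : (forall e, 0 < e -> x <= C * (D + e)) -> x <= C * D.
  move=> h; apply/ler_addgt0Pr => e e0; have := h (e / C) (divr_gt0 e0 C0).
  by rewrite mulrDr [C * (e / C)]mulrC divfK// gt_eqF.
have RcD : R_const R m n <= C * D.
  apply: limit => e e0; apply: R_const_le => r hr.
  rewrite -[leRHS]mul1r -ler_pdivrMr ?De0//.
  apply: (@le1_of_le_expr _ _ m) => V0 V00.
  have [U [V [U0 /andP[V0' VV0] hgap E]]] := gaps _ _ e0 hr _ V00.
  exists V; first by rewrite V0'.
  have := gap_volume_le U0 V0' hgap.
  by rewrite -[X in X <= _]invrK E invf_div.
have B1 : 1 <= B by rewrite /B ler_pdivlMr// mul1r.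
split=> //.
have s2 : 0 < (2 * s) ^+ (m + n) by rewrite exprn_gt0// mulr_gt0.
have ub e r : 0 < e -> 0 < r < 1 -> (approx_liminf Theta alpha <=
    ((2 * s) ^+ (m + n) * (C * (D + e) / (r ^+ n * (1 - r) ^+ m)))%:E)%E.
  by move=> e0 hr; apply: approx_liminf_le => //; exact: gaps.
have := approx_liminf_ge0 Theta alpha.
case: (approx_liminf Theta alpha) ub => [l ub l0|ub _|//]; last first.
  by have := ub _ _ ltr01 half; rewrite leye_eq.
rewrite !lee_fin in l0 *.
have [->|l_neq0] := eqVneq l 0.
  by rewrite mulr_ge0 ?(ltW s2)// (le_trans ler01).
have lgt0 : 0 < l by rewrite lt0r l_neq0.
have S0 : 0 < (2 * s) ^+ (m + n) / l by rewrite divr_gt0.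
suff h : R_const R m n / ((2 * s) ^+ (m + n) / l) <= C * D.
  rewrite ler_pdivrMr// in h; rewrite /B mulrA ler_pdivlMr//.
  rewrite (le_trans (ler_wpM2l (ltW lgt0) h))// le_eqVlt; apply/orP; left; apply/eqP.
  by field.
apply: limit => e e0; rewrite ler_pdivrMr//; apply: R_const_le => r hr.
have := ub _ _ e0 hr; rewrite lee_fin mulrA ler_pdivlMr ?prod_gt0// => h.
by rewrite mulrA ler_pdivlMr// mulrC [leRHS]mulrC.
Qed.

Lemma G_constE (R : realType) (m n : nat) (eps D : R) : 0 < eps ->
  let d := (m + n)%N in
  G_const m n eps * D ^+ (d * d.-1) =
  (d%:R / K_const R d ^+ d.-1) ^+ d *
  ((n%:R ^+ n * m%:R ^+ m) / eps ^+ d * D / R_const R m n) ^+ (d * d.-1).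
Proof.
move=> eps0 d; rewrite /G_const -/d /=.
set K := K_const R d; set Rc := R_const R m n.
rewrite [eps ^+ d * K * Rc]mulrAC -[in LHS]mulrA [in LHS]mulrC.
rewrite !expr_div_n !exprMn !invfM !exprVn [in RHS]mulnC.
by rewrite exprM -!exprM [(d.-1 * d)%N]mulnC; ring.
Qed.

Theorem theorem1 (R : realType) (m n : nat) (m_gt0 : (0 < m)%N)
    (n_gt0 : (0 < n)%N) (Theta : 'M[R]_(n, m))
    (last : option nat) (y : nat -> 'rV[int]_n)
    (best_y : best_approximations Theta^T last y)
    (eta : 'rV[R]_n) (etaN : nonsingular_shifts last y eta)
    (eps : R) (eps_gt0 : 0 < eps) (le_eps : eps <= inf_dist last y eta)
    (alpha : 'rV[R]_n) :
  (approx_liminf Theta alpha <=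
    (G_const m n eps)%:E
    * approx_liminf Theta eta ^+ ((m + n) * (m + n).-1))%E.
Proof.
have [k dE] : exists k, (m + n = k.+2)%N.
  by exists (m + n).-2; move: m_gt0 n_gt0; lia.
have K0 : 0 < K_const R (m + n) by rewrite dE; exact: K_const_gt0.
have p0 : (0 < (m + n) * (m + n).-1)%N by rewrite dE.
pose s : R := (m + n)%:R / (2 * K_const R (m + n) ^+ (m + n).-1).
have s0 : 0 < s by rewrite divr_gt0 ?mulr_gt0 ?exprn_gt0// dE ltr0n.
have hs : covering_const R (n + m) < s ^+ 2.
  by rewrite /s [(n + m)%N]addnC dE; exact: covering_const_lt.
have := approx_liminf_ge0 Theta eta.
case limE : (approx_liminf Theta eta) => [D| |//] D0.
  have [B1 le_alpha] := liminf_bounds alpha m_gt0 n_gt0 best_y eps_gt0 le_eps limE s0 hs.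
  apply: (le_trans le_alpha); rewrite -EFin_expe -EFinM lee_fin G_constE//.
  have -> : 2 * s = (m + n)%:R / K_const R (m + n) ^+ (m + n).-1.
    by rewrite /s; field; rewrite expf_neq0// gt_eqF.
  rewrite ler_wpM2l//; last by rewrite -[leLHS]expr1 ler_weXn2l.
  by rewrite exprn_ge0// divr_ge0 ?exprn_ge0// ltW.
(* The case Delta = +oo, where the positivity of G is what matters. *)
have ypow p : (0 < p)%N -> (+oo ^+ p)%E = +oo%E :> \bar R.
  elim: p => [//|[|p] IH] _; first by rewrite expeS expe0 mule1.
  by rewrite expeS IH// mulyy.
rewrite ypow// gt0_muley ?leey// lte_fin.
have mR : 0 < m%:R :> R by rewrite ltr0n.
have nR : 0 < n%:R :> R by rewrite ltr0n.
have dR : 0 < (m + n)%:R :> R by rewrite ltr0n dE.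
rewrite /G_const /=; move: K0 (R_const_gt0 R m n).
move: (K_const _ _) (R_const _ _ _) => K Rc K0 Rc0.
by rewrite divr_gt0 ?mulr_gt0 ?exprn_gt0 ?mulr_gt0 ?exprn_gt0.
Qed.
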